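(* There is a function $h(c,d,k)$ such that the following holds. Let $c\geq1$, $d\geq0$ be integers and $k$ a constant, let $H=(V,E)$ be a $(c,d)$-hypergraph and let $\beta\colon V\to[0,1]$ with $\operatorname{weight}(\beta)\leq k$. Then there is $\nu\colon V\to[0,1]$ such that $\operatorname{weight}(\nu)\leq k$, $B_v(\beta)\subseteq B_v(\nu)$ and $|\operatorname{vsupport}(\nu)|\leq h(c,d,k)$.
   Context: A hypergraph $H=(V,E)$ has a finite vertex set $V$ and a set $E$ of non-empty subsets of $V$; it is a $(c,d)$-hypergraph if any $c$ distinct edges have at most $d$ common vertices. For $\beta\colon V\to[0,1]$: $B_v(\beta)=\{e\in E\mid\sum_{v\in e}\beta(v)\geq1\}$ (edges covered by $\beta$), $\operatorname{vsupport}(\beta)=\{v\in V\mid\beta(v)>0\}$, and $\operatorname{weight}(\beta)=\sum_{v\in V}\beta(v)$. *)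

(* Defs.v *)
From HB Require Import structures.
From mathcomp Require Import all_boot all_order all_algebra.
From mathcomp Require Import reals.

Set Implicit Arguments.
Unset Strict Implicit.
Unset Printing Implicit Defensive.

Import Order.TTheory GRing.Theory Num.Theory.

Local Open Scope ring_scope.

Record hypergraph (V : finType) := Hypergraph {
  edges : {set {set V}};
  edges_nonempty : set0 \notin edges
}.

(* A set C of cardinality c is the same as a choice of c distinct edges. For
   c = 0 the intersection over the empty family is the whole vertex set. *)
Definition cd_hypergraph (c d : nat) (V : finType) (H : hypergraph V) : Prop :=
  forall C : {set {set V}}, C \subset edges H -> #|C| = c ->
    (#|\bigcap_(e in C) e| <= d)%N.

Section VertexWeights.
Variables (R : realType) (V : finType).
Implicit Types (H : hypergraph V) (beta : V -> R).

Definition unit_valued beta : Prop := forall v, 0 <= beta v <= 1.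

Definition covered H beta : {set {set V}} :=
  [set e in edges H | 1 <= \sum_(v in e) beta v].

Definition vsupport beta : {set V} := [set v | 0 < beta v].

Definition weight beta : R := \sum_(v : V) beta v.

End VertexWeights.

(* Main.v *)
Require Import Defs.
From HB Require Import structures.
From mathcomp Require Import boolp classical_sets filter topology normedtype.
From mathcomp Require Import all_boot all_order all_algebra.
From mathcomp Require Import reals.
From mathcomp Require Import ring lra.

Import Order.TTheory GRing.Theory Num.Theory.
Import numFieldNormedType.Exports.

Local Open Scope ring_scope.

(** By contradiction and compactness. Take instances (V n, beta n) whose best
covers have unbounded support, and a nonprincipal ultrafilter U on nat. A
sequence of vertex sets is asymptotically covered when the U-limit of its mass
is at least 1. There are finitely many asymptotically covered sequences A_i such
that, for U-almost all n, every covered edge contains some A_i n: starting from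
the empty set, a sequence K that is not asymptotically covered leaves a fixed
mass to be collected outside K by each edge through it; double counting shows
that boundedly many edges collect it on light vertices only, all others pass
through one of boundedly many heavy vertices, and adding these one at a time
stops at size d + 1, where fewer than c edges remain. Now sort the vertices by
which A_i n they belong to, and move the U-limit of the mass of each class to
one vertex of that class: the limit inequalities are exact, so this assignment
covers every A_i n, has weight at most k, and its support is bounded by the
number of classes. Values above 1 are harmlessly truncated. *)

(** * Double counting of edges on light vertices *)

(** Induction on the number [r] of vertices that [S] lacks to reach size [d.+1]. At most [d] light
    vertices carry at most [eps / 2], so each edge through [S] keeps [eps / 2] outside [S]. Summing
    this over the edges and exchanging sums costs a factor [2 * k / eps] per added vertex. *)
Lemma card_edges_through_le (R : realFieldType) (V : finType) (w : V -> R)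
    (F : {set {set V}}) (k eps : R) (c d : nat) :
  (forall v, 0 <= w v) -> \sum_v w v <= k -> 0 < eps ->
  (forall e, e \in F -> eps <= \sum_(v in e) w v) ->
  (forall v, d%:R * w v <= eps / 2) ->
  (forall S : {set V}, #|S| = d.+1 -> (#|[set e in F | S \subset e]| <= c)%N) ->
  forall r (S : {set V}), (#|S| + r = d.+1)%N ->
    #|[set e in F | S \subset e]|%:R <= c%:R * (2 * k / eps) ^+ r.
Proof.
move=> w0 wk eps0 wF wd Fc; have k0 : 0 <= k.
  by apply: le_trans wk; apply: sumr_ge0.
elim=> [S|r IHr S Sr]; first by rewrite addn0 expr0 mulr1 ler_nat; apply: Fc.
set FS := [set e in F | S \subset e].
have Sd : (#|S| <= d)%N by rewrite -ltnS -Sr addnS ltnS leq_addr.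
have lowS e : e \in FS -> eps / 2 <= \sum_(v in e :\: S) w v.
  rewrite inE => /andP[eF Se].
  have wS : \sum_(v in S) w v <= eps / 2.
    have [d0|d0] := posnP d.
      have /eqP : #|S| = 0%N by apply/eqP; rewrite -leqn0 -d0.
      by rewrite cards_eq0 => /eqP ->; rewrite big_set0; lra.
    have d0' : 0 < d%:R :> R by rewrite ltr0n.
    apply: (@le_trans _ _ (\sum_(v in S) (eps / 2 / d%:R))).
      by apply: ler_sum => v _; rewrite ler_pdivlMr // mulrC.
    rewrite sumr_const -[leLHS]mulr_natr.
    have -> : eps / 2 / d%:R * #|S|%:R = (eps / 2) * (#|S|%:R / d%:R) by ring.
    rewrite ger_pMr; last by lra.
    by rewrite ler_pdivrMr // mul1r ler_nat.
  move: (wF _ eF); rewrite (big_setID S) /= (setIidPr Se); lra.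
have sumFS : \sum_(e in FS) \sum_(v in e :\: S) w v <= k * (c%:R * (2 * k / eps) ^+ r).
  rewrite (exchange_big_dep (fun v => v \notin S)) /=; last first.
    by move=> e v _; rewrite inE => /andP[].
  apply: (@le_trans _ _ (\sum_(v | v \notin S) w v * (c%:R * (2 * k / eps) ^+ r))).
    apply: ler_sum => v vS; rewrite sumr_const -[leLHS]mulr_natr.
    apply: ler_wpM2l => //.
    have := IHr (v |: S); rewrite cardsU1 vS add1n addSnnS => /(_ Sr).
    apply: le_trans; rewrite ler_nat; apply: subset_leq_card; apply/subsetP => e.
    rewrite unfold_in /= !inE subUset sub1set.
    by move=> /andP[/andP[-> ->] /andP[_ ->]].
  rewrite -mulr_suml; apply: ler_wpM2r.
    by rewrite mulr_ge0 // exprn_ge0 // divr_ge0 ?mulr_ge0 // ltW.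
  by apply: le_trans wk; rewrite [leRHS](bigID (mem S)) /= lerDr sumr_ge0.
have cardFS : #|FS|%:R * (eps / 2) <= k * (c%:R * (2 * k / eps) ^+ r).
  by apply: le_trans sumFS; rewrite mulr_natl -sumr_const; apply: ler_sum.
move: cardFS; rewrite -ler_pdivlMr; last by lra.
move=> /le_trans; apply; rewrite exprS le_eqVlt; apply/orP; left; apply/eqP.
by field; rewrite gt_eqF.
Qed.

(** * Finite kernels along an ultrafilter *)

Section UltraproductKernel.
Variables (R : realType) (k : R) (c d : nat) (V : nat -> finType).
Variables (B : forall n, {set {set V n}}) (beta : forall n, V n -> R).
Arguments beta {n}.
Hypothesis beta_ge0 : forall n (v : V n), 0 <= beta v.
Hypothesis weight_le : forall n, weight (@beta n) <= k.
Hypothesis weight_ge1 : forall n, 1 <= weight (@beta n).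
Hypothesis B_covered :
  forall n (e : {set V n}), e \in B n -> 1 <= \sum_(v in e) beta v.
Hypothesis card_V : forall n, (d < #|V n|)%N.
Hypothesis B_through : forall n (S : {set V n}), (d < #|S|)%N ->
  (#|[set e in B n | S \subset e]| <= c)%N.
Variable U : set_system nat.
Hypothesis U_ultra : UltraFilter U.

Let k_ge0 : 0 <= k.
Proof. by apply: le_trans (weight_le 0); apply: sumr_ge0. Qed.

Definition asymptotically_covered (A : forall n, {set V n}) : Prop :=
  forall eps : R, 0 < eps ->
    \forall n \near U, 1 - eps <= \sum_(v in A n) beta v.

(** The index type [I] is chosen before [n]; this makes the final support bound uniform in [n]. *)
Definition asymptotic_kernel (F : forall n, {set {set V n}}) : Prop :=
  exists (I : finType) (A : I -> forall n, {set V n}),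
    (forall i, asymptotically_covered (A i)) /\
    \forall n \near U, forall e, e \in F n -> exists i, A i n \subset e.

Lemma asymptotic_kernel_bounded_card (F : forall n, {set {set V n}}) (M : nat) :
  (forall n, F n \subset B n) ->
  (\forall n \near U, (#|F n| <= M)%N) -> asymptotic_kernel F.
Proof.
move=> FB FM.
(* The edges themselves form the kernel. Past the end of the enumeration the default is the full
   vertex set, covered by [weight_ge1]. *)
exists ('I_M : finType), (fun (i : 'I_M) n => nth [set: V n] (enum (F n)) i); split.
  move=> i eps eps0; apply: nearW => n.
  apply: (@le_trans _ _ 1); first by lra.
  have [iF|iF] := ltnP i (size (enum (F n))).
    apply: B_covered; apply: (subsetP (FB n)).
    by rewrite -mem_enum mem_nth.
  rewrite nth_default //; apply: le_trans (weight_ge1 n) _.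
  by rewrite /weight le_eqVlt; apply/orP; left; apply/eqP/eq_bigl => v; rewrite inE.
apply: filterS FM => n FM e eF.
have ie : (index e (enum (F n)) < M)%N.
  by apply: leq_trans FM; rewrite cardE index_mem mem_enum.
by exists (Ordinal ie); rewrite nth_index ?mem_enum.
Qed.

Lemma asymptotic_kernel_bigcup (I : finType) (F : I -> forall n, {set {set V n}})
    (G : forall n, {set {set V n}}) :
  (forall i, asymptotic_kernel (F i)) ->
  (\forall n \near U, forall e, e \in G n -> exists i, e \in F i n) ->
  asymptotic_kernel G.
Proof.
move=> kF GF; have [J {}kF] := boolp.choice kF.
have /all_tag[A kA] := fun i => cid (kF i).
exists ({i : I & J i} : finType), (fun ij : {i : I & J i} => A (tag ij) (tagged ij)); split.
  by move=> [i j]; apply: (kA i).1.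
have kAU : \forall n \near U, forall i e, e \in F i n ->
    exists j, A i j n \subset e.
  by apply: filter_forall => i; exact: (kA i).2.
apply: filterS2 GF kAU => n GF kAn e /GF[i eF].
by have [j] := kAn i e eF; exists (Tagged J j).
Qed.

(** A covered edge collects at least [eps] outside [K n]. If it meets only light vertices there,
    double counting from the empty set bounds the number of such edges independently of [n]. *)
Lemma asymptotic_kernel_light (K : forall n, {set V n}) (eps eta : R) :
  0 < eps -> d%:R * eta <= eps / 2 -> 0 <= eta ->
  (\forall n \near U, \sum_(v in K n) beta v < 1 - eps) ->
  asymptotic_kernel (fun n => [set e in B n | [forall v in e :\: K n, beta v <= eta]]).
Proof.
move=> eps0 deta eta0 Keps.
set F := fun n => _.
apply: (asymptotic_kernel_bounded_card F
  (Num.bound (c%:R * (2 * k / eps) ^+ d.+1))).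
  by move=> n; apply/subsetP => e; rewrite inE => /andP[].
apply: filterS Keps => n Keps.
pose w v := if (v \notin K n) && (beta v <= eta) then beta v else 0.
have wb v : w v <= beta v by rewrite /w; case: ifP.
have w0 v : 0 <= w v by rewrite /w; case: ifP.
have weta v : w v <= eta by rewrite /w; case: ifP => // /andP[].
have := @card_edges_through_le R (V n) w (F n) k eps c d w0 _ eps0 _ _ _ d.+1 finset.set0.
rewrite cards0 add0n.
have -> : [set e in F n | finset.set0 \subset e] = F n.
  by apply/setP => e; rewrite inE sub0set andbT.
rewrite -(ler_nat R) => H; apply: le_trans (ltW (archi_boundP _)); last first.
  by rewrite mulr_ge0 // exprn_ge0 // divr_ge0 ?mulr_ge0 // ltW.
apply: H => //.
- by apply: le_trans (weight_le n); apply: ler_sum.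
- move=> e; rewrite inE => /andP[eB /'forall_implyP elight].
  have := B_covered _ _ eB; rewrite (big_setID (K n)) /=.
  have KeK : \sum_(v in e :&: K n) beta v <= \sum_(v in K n) beta v.
    rewrite [leRHS](big_setID e) /= setIC lerDl.
    by apply: sumr_ge0.
  have we : \sum_(v in e :\: K n) beta v <= \sum_(v in e) w v.
    rewrite [leRHS](big_setID (K n)) /= -[leLHS]add0r lerD //.
      exact: sumr_ge0.
    apply: ler_sum => v ve; rewrite /w elight //.
    by move: ve; rewrite inE => /andP[->].
  lra.
- by move=> v; apply: le_trans deta; apply: ler_wpM2l.
- move=> S Sd; apply: leq_trans (B_through n S _); last by rewrite Sd.
  apply: subset_leq_card; apply/subsetP => e.
  by rewrite !inE => /andP[] /andP[-> _] ->.
Qed.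

Lemma card_heavy_le n (eta : R) : 0 < eta ->
  (#|[set v : V n | (eta < beta v)%R]| <= Num.bound (k / eta))%N.
Proof.
move=> eta0; rewrite -(ler_nat R); apply: le_trans (ltW (archi_boundP _)); last first.
  by rewrite divr_ge0 // ltW.
rewrite ler_pdivlMr // mulr_natl -sumr_const; apply: le_trans (weight_le n).
rewrite /weight [leRHS](bigID (mem [set v : V n | eta < beta v])) /=.
apply: ler_wpDr; first exact: sumr_ge0.
by apply: ler_sum => v; rewrite inE => /ltW.
Qed.

(** Induction on [j], which bounds how many vertices must still be added to exceed size [d]; at
    [j = 0] at most [c] edges remain. *)
Lemma asymptotic_kernel_through j (K : forall n, {set V n}) :
  (forall n, d < #|K n| + j)%N ->
  asymptotic_kernel (fun n => [set e in B n | K n \subset e]).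
Proof.
elim: j K => [|j IHj] K Kj.
  apply: (asymptotic_kernel_bounded_card _ c).
    by move=> n; apply/subsetP => e; rewrite inE => /andP[].
  by apply: nearW => n; apply: B_through; rewrite -[#|_|]addn0.
have [Kcov|] := pselect (asymptotically_covered K).
  exists (unit : finType), (fun _ => K); split => //.
  by apply: nearW => n e; rewrite inE => /andP[_ Ke]; exists tt.
move=> /existsNP[eps] /not_implyP[eps0 Keps].
(* For an ultrafilter, an event that is not large has a large complement. *)
have {}Keps : \forall n \near U, \sum_(v in K n) beta v < 1 - eps.
  have [//|] := in_ultra_setVsetC (fun n => 1 - eps <= \sum_(v in K n) beta v) U_ultra.
  by apply: filterS => n /negP; rewrite -ltNge.
(* Chosen so that [d] light vertices weigh at most [eps / 2]; the successor keeps the denominator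
   nonzero when [d = 0]. *)
pose eta := eps / (2 * d.+1%:R).
have eta0 : 0 < eta by rewrite divr_gt0 // mulr_gt0.
have deta : d%:R * eta <= eps / 2.
  have -> : eps / 2 = d.+1%:R * eta.
    rewrite /eta; have : d.+1%:R != 0 :> R by rewrite pnatr_eq0.
    by move: d.+1%:R => D D0; field.
  by apply: ler_wpM2r; [exact: ltW|rewrite ler_nat].
have light := asymptotic_kernel_light K eps eta eps0 deta (ltW eta0) Keps.
pose heavy n := enum [set v : V n | (eta < beta v) && (v \notin K n)].
(* Adds the [i]-th heavy vertex to [K n]. The default, the full vertex set, is large enough for the
   induction hypothesis by [card_V]. *)
pose K' (i : 'I_(Num.bound (k / eta))) n :=
  nth [set: V n] [seq v |: K n | v <- heavy n] i.
have kerK' i : asymptotic_kernel (fun n => [set e in B n | K' i n \subset e]).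
  apply: IHj => n; rewrite /K'.
  have [ih|ih] := ltnP i (size [seq v |: K n | v <- heavy n]).
    have /mapP[v] := mem_nth [set: V n] ih.
    rewrite mem_enum inE => /andP[_ vK] ->.
    by rewrite cardsU1 vK add1n addSnnS.
  rewrite nth_default // cardsT; apply: leq_trans (card_V n) (leq_addr _ _).
(* [None] stands for the light edges, [Some i] for the edges through [K' i]. *)
apply: (@asymptotic_kernel_bigcup (option 'I_(Num.bound (k / eta)))
  (fun o => if o is Some i then (fun n => [set e in B n | K' i n \subset e])
   else fun n => [set e in B n | [forall v in e :\: K n, beta v <= eta]])).
  by case.
apply: nearW => n e; rewrite inE => /andP[eB Ke].
have [el|] := boolP [forall v in e :\: K n, beta v <= eta].
  by exists None; rewrite inE eB.
rewrite negb_forall => /existsP[v]; rewrite negb_imply inE -ltNge.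
move=> /andP[/andP[vK ve] vh].
have vheavy : v \in heavy n by rewrite mem_enum inE vh.
have iv : (index v (heavy n) < Num.bound (k / eta))%N.
  apply: leq_trans (card_heavy_le n _ eta0).
  apply: (@leq_trans (size (heavy n))); first by rewrite index_mem.
  rewrite -cardE; apply: subset_leq_card; apply/subsetP => u.
  by rewrite !inE => /andP[].
exists (Some (Ordinal iv)); rewrite inE eB /= /K' /=.
by rewrite (nth_map v) ?index_mem // nth_index // subUset sub1set ve.
Qed.

(** * Limit masses and the cover of bounded support *)

(** Compactness gives a cluster point, and an ultrafilter converges to each of its cluster
    points. *)
Lemma ultralimit_bounded (u : nat -> R) (a b : R) :
  (forall n, a <= u n <= b) -> exists l : R, (u n @[n --> U] --> l)%classic.
Proof.
move=> uab.
have [l [_ lcluster]] : (`[a, b]%classic `&` cluster (u n @[n --> U]) !=set0)%classic.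
  by apply: segment_compact; apply: nearW => n; rewrite /= in_itv /=.
exists l => A lA.
have [//|nA] := in_ultra_setVsetC (u @^-1` A)%classic U_ultra.
by have [x []] := lcluster (~` A)%classic A nA lA.
Qed.

Lemma bounded_support_cover :
  exists m, \forall n \near U, exists nu : V n -> R,
    [/\ unit_valued nu, weight nu <= k,
        forall e, e \in B n -> 1 <= \sum_(v in e) nu v
      & (#|vsupport nu| <= m)%N].
Proof.
have [I [A [Acov Aker]]] :=
  asymptotic_kernel_through d.+1 (fun n => finset.set0) (fun n => leq_addl _ _).
(* Each [A i n] is the disjoint union of the classes whose type contains [i], so its mass is a
   finite sum of class masses. *)
pose type n (v : V n) := [set i | v \in A i n].
pose mu n (T : {set I}) := \sum_(v | type n v == T) beta v.
have mu_le n T : 0 <= mu n T <= k.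
  rewrite sumr_ge0 //=; apply: le_trans (weight_le n).
  by rewrite /weight [leRHS](bigID (fun v => type n v == T)) /= lerDl sumr_ge0.
have [l lcvg] := boolp.choice (fun T => ultralimit_bounded (mu ^~ T) 0 k (mu_le ^~ T)).
have sum_lcvg (P : pred {set I}) :
    (\sum_(T | P T) mu n T @[n --> U] --> \sum_(T | P T) l T)%classic.
  apply: cvg_big => //; exact: add_continuous.
have l_ge0 T : 0 <= l T.
  by apply: (cvgr_to_ge (lcvg T)); apply: nearW => n; have /andP[] := mu_le n T.
have l_le : \sum_T l T <= k.
  apply: (cvgr_to_le (sum_lcvg xpredT)); apply: nearW => n.
  by apply: le_trans (weight_le n); rewrite /weight (partition_big (type n) xpredT).
have l_ge1 (i : I) : 1 <= \sum_(T : {set I} | i \in T) l T.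
  apply/ler_addgt0Pr => eps eps0; rewrite -lerBlDr.
  apply: (cvgr_to_ge (sum_lcvg (fun T : {set I} => i \in T))).
  apply: filterS (Acov i eps eps0) => n /le_trans; apply.
  rewrite (partition_big (type n) (fun T : {set I} => i \in T)) /=; last first.
    by move=> v vA; rewrite inE.
  apply: ler_sum => T iT; rewrite le_eqVlt; apply/orP; left; apply/eqP.
  apply: eq_bigl => v; have [vT|] := eqVneq (type n v) T; last by rewrite andbF.
  by rewrite andbT; move: iT; rewrite -vT inE => ->.
(* A class with positive limit mass is nonempty for almost all [n], so it has a vertex to receive
   that mass. *)
have l_pos : \forall n \near U, forall T, 0 < l T -> 0 < mu n T.
  apply: filter_forall => T; have [lT|lT] := boolP (0 < l T); last exact: nearW.
  by apply: filterS (cvgr_gt _ (lcvg T) _ lT).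
exists #|{set I}|; apply: filterS2 Aker l_pos => n Aker l_pos.
pose rep T := [pick v : V n | type n v == T].
pose nu v := if rep (type n v) == Some v then l (type n v) else 0.
have nu0 v : 0 <= nu v by rewrite /nu; case: ifP.
have sum_nu T : \sum_(v | type n v == T) nu v = l T.
  have repT : rep T = [pick v : V n | type n v == T] by [].
  move: repT; case: pickP => [v /eqP vT repT|noT repT].
    rewrite (bigD1 v) /=; last by rewrite vT.
    rewrite {1}/nu vT repT eqxx big1 ?addr0 // => u /andP[/eqP uT uv].
    by rewrite /nu uT repT; case: eqP => // -[vu]; rewrite vu eqxx in uv.
  rewrite big_pred0 //; apply/eqP; rewrite eq_le l_ge0 leNgt /=; apply/negP.
  by move=> /l_pos; rewrite /mu big_pred0 // ltxx.
pose nu1 v := Num.min 1 (nu v).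
have nu1_le v : nu1 v <= nu v by rewrite /nu1 ge_min lexx orbT.
have nu1_ge0 v : 0 <= nu1 v by rewrite /nu1 le_min ler01 nu0.
exists nu1; split.
- by move=> v; rewrite nu1_ge0 /nu1 ge_min lexx.
- apply: le_trans l_le; rewrite /weight (partition_big (type n) xpredT) //=.
  by apply: ler_sum => T _; rewrite -(sum_nu T); apply: ler_sum.
- move=> e eB; have [|i Aie] := Aker e; first by rewrite inE eB sub0set.
  (* Either one vertex with [nu v] at least 1 covers [e] alone, or truncation changes nothing on
     [e]. *)
  have [/existsP[v /andP[ve v1]]|] := boolP [exists v, (v \in e) && (1 <= nu v)].
    rewrite (bigD1 v) //=; apply: ler_wpDr; first exact: sumr_ge0.
    by rewrite /nu1 le_min lexx.
  rewrite negb_exists => /forallP small.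
  have -> : \sum_(v in e) nu1 v = \sum_(v in e) nu v.
    apply: eq_bigr => v ve; rewrite /nu1; apply/min_idPr.
    by have := small v; rewrite ve -ltNge => /ltW.
  apply: (le_trans (l_ge1 i)).
  rewrite (big_setID (A i n)) /= (setIidPr Aie) -[leLHS]addr0 lerD ?sumr_ge0 //.
  rewrite [leRHS](partition_big (type n) (fun T : {set I} => i \in T)) /=; last first.
    by move=> v vA; rewrite inE.
  apply: ler_sum => T iT; rewrite -(sum_nu T) le_eqVlt; apply/orP; left; apply/eqP.
  apply: eq_bigl => v; have [vT|] := eqVneq (type n v) T; last by rewrite andbF.
  by rewrite andbT; move: iT; rewrite -vT inE => ->.
(* Only class representatives have positive value, so [type n] is injective on the support. *)
- rewrite -(card_in_imset (f := type n)) ?max_card // => u v.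
  rewrite !inE /nu1 !lt_min !ltr01 /= /nu.
  case: ifP => [/eqP ru _|]; last by rewrite ltxx.
  case: ifP => [/eqP rv _|]; last by rewrite ltxx.
  by move=> uv; move: ru; rewrite uv rv => -[].
Qed.

End UltraproductKernel.

(** * From a sequence of counterexamples to the bound *)

Lemma card_edges_through_lt (c d : nat) (V : finType) (H : hypergraph V)
    (S : {set V}) :
  cd_hypergraph c d H -> (d < #|S|)%N ->
  (#|[set e in edges H | S \subset e]| < c)%N.
Proof.
move=> Hcd dS; rewrite ltnNge; apply/negP => /card_geqP[s [us ss sE]].
have sHS e : e \in s -> (e \in edges H) && (S \subset e).
  by move=> /sE; rewrite inE.
have : (#|\bigcap_(e in [set:: s]) e| <= d)%N.
  apply: Hcd; last by rewrite cardsE (card_uniqP us).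
  by apply/subsetP => e; rewrite inE => /sHS/andP[].
rewrite leqNgt => /negP; apply; apply: leq_trans dS (subset_leq_card _).
by apply/bigcapsP => e; rewrite inE => /sHS/andP[].
Qed.

Theorem theorem5p6 (R : realType) :
  exists h : nat -> nat -> R -> nat,
    forall (c d : nat) (k : R), (1 <= c)%N ->
    forall (V : finType) (H : hypergraph V) (beta : V -> R),
      cd_hypergraph c d H -> unit_valued beta -> weight beta <= k ->
      exists nu : V -> R,
        [/\ unit_valued nu,
            weight nu <= k,
            covered H beta \subset covered H nu
          & (#|vsupport nu| <= h c d k)%N].
Proof.
suff bound (c d : nat) (k : R) : exists m : nat,
    forall (V : finType) (H : hypergraph V) (beta : V -> R),
      cd_hypergraph c d H -> unit_valued beta -> weight beta <= k ->
      exists nu : V -> R,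
        [/\ unit_valued nu,
            weight nu <= k,
            covered H beta \subset covered H nu
          & (#|vsupport nu| <= m)%N].
  have [h hP] := boolp.choice (fun x : nat * nat * R => bound x.1.1 x.1.2 x.2).
  by exists (fun c d k => h (c, d, k)) => c d k _; apply: hP (c, d, k).
apply: contrapT => /forallNP unbounded.
pose counterexample m (X : {V : finType & hypergraph V * (V -> R)}%type) :=
  let: existT V (H, beta) := X in
  [/\ cd_hypergraph c d H, unit_valued beta, weight beta <= k &
    forall nu : V -> R, unit_valued nu -> weight nu <= k ->
      covered H beta \subset covered H nu -> (m < #|vsupport nu|)%N].
have cex m : exists X, counterexample m X.
  have /existsNP[V /existsNP[H /existsNP[beta]]] := unbounded m.
  move=> /not_implyP[Hcd /not_implyP[beta01 /not_implyP[betak nonu]]].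
  exists (existT _ V (H, beta)); split=> // nu nu01 nuk Bnu.
  by rewrite ltnNge; apply/negP => num; apply: nonu; exists nu.
(* The shift by [d] forces every instance to have more than [d] vertices, since [beta] is itself an
   admissible cover. *)
have [X Xcex] := boolp.choice (fun n => cex (n + d)%N).
have [U [U_ultra Uoo]] := ultraFilterLemma eventually_filter.
pose V n := tag (X n); pose H n : hypergraph (V n) := (tagged (X n)).1.
pose beta n : V n -> R := (tagged (X n)).2.
have {}Xcex n : [/\ cd_hypergraph c d (H n), unit_valued (beta n),
    weight (beta n) <= k &
    forall nu : V n -> R, unit_valued nu -> weight nu <= k ->
      covered (H n) (beta n) \subset covered (H n) nu ->
      (n + d < #|vsupport nu|)%N].
  by rewrite /V /H /beta; move: (Xcex n); case: (X n) => W [].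
have [||||||m Um] := @bounded_support_cover R k c d V
  (fun n => covered (H n) (beta n)) beta _ _ _ _ _ _ U U_ultra.
- by move=> n v; have [_ /(_ v)/andP[]] := Xcex n.
- by move=> n; have [] := Xcex n.
- move=> n; have [Hcd b01 bk nonu] := Xcex n.
  (* With total weight below 1 no edge is covered, so the zero function would be a cover with empty
     support. *)
  have [//|b1] := leP 1 (weight (beta n)).
  have := nonu (fun _ => 0).
  have -> : vsupport (fun _ : V n => 0 : R) = finset.set0.
    by apply/setP => v; rewrite !inE ltxx.
  rewrite cards0 ltn0 => nonu0; suff: false by [].
  apply: nonu0; first by move=> v; rewrite lexx ler01.
    by rewrite /weight big1 //; apply: le_trans bk; apply: sumr_ge0 => v _;
      have /andP[] := b01 v.
  apply/subsetP => e; rewrite inE => /andP[_]; rewrite leNgt => /negP[].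
  apply: le_lt_trans b1.
  rewrite /weight [leRHS](bigID (mem e)) /= lerDl sumr_ge0 // => v _.
  by have /andP[] := b01 v.
- by move=> n e; rewrite inE => /andP[].
- move=> n; have [_ b01 bk /(_ (beta n) b01 bk (subxx _))] := Xcex n.
  move=> /leq_trans/(_ (max_card _)); apply: leq_ltn_trans; exact: leq_addl.
- move=> n S dS; have [Hcd _ _ _] := Xcex n.
  apply: leq_trans (ltnW (card_edges_through_lt _ _ _ _ _ Hcd dS)).
  apply: subset_leq_card; apply/subsetP => e.
  by rewrite !inE => /andP[] /andP[-> _] ->.
(* [U] refines the cofinite filter, so some index [n] is at least [m] and also has a cover with
   support at most [m]. *)
have : \forall n \near U, (m <= n)%N by apply: Uoo; exact: nbhs_infty_ge.
move=> /(filterI Um)/filter_ex[n [[nu [nu01 nuk nucov num]] mn]].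
have [_ _ _ /(_ nu nu01 nuk)] := Xcex n.
suff -> : covered (H n) (beta n) \subset covered (H n) nu.
  move=> /(_ isT); rewrite ltnNge => /negP[].
  exact: leq_trans num (leq_trans mn (leq_addr _ _)).
apply/subsetP => e eB; rewrite inE nucov // andbT.
by move: eB; rewrite inE => /andP[].
Qed.
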